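(* Let $\mathbb{K}$ be a commutative field, $U$ and $V$ be $\mathbb{K}$-vector spaces (possibly infinite-dimensional), and $\mathcal{S}$ be an $n$-dimensional LLD linear subspace of $\mathcal{L}(U,V)$, with $\#\mathbb{K}\geq n$. Then, either $\mathcal{S}$ contains a non-zero element of rank less than $n-1$, or else all the non-zero elements of $\mathcal{S}$ have rank $n-1$.
   Context: $\mathcal{L}(U,V)$ is the space of all linear operators from $U$ to $V$. A finite-dimensional linear subspace $\mathcal{S}$ of $\mathcal{L}(U,V)$ is LLD (locally linearly dependent) when for every $x\in U$ there is a non-zero $f\in\mathcal{S}$ with $f(x)=0$. *)

(* Defs.v *)
From mathcomp Require Import all_boot all_order all_algebra.
From mathcomp Require Import boolp classical_sets functions cardinality.

Set Implicit Arguments.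
Unset Strict Implicit.
Unset Printing Implicit Defensive.

Import GRing.Theory.
Local Open Scope classical_set_scope.
Local Open Scope ring_scope.

Definition lin_indep (K : fieldType) (W : lmodType K) (n : nat)
    (e : 'I_n -> W) : Prop :=
  forall c : 'I_n -> K, \sum_(i < n) c i *: e i = 0 -> forall i, c i = 0.

Definition lin_span (K : fieldType) (W : lmodType K) (n : nat)
    (e : 'I_n -> W) : set W :=
  [set w | exists c : 'I_n -> K, w = \sum_(i < n) c i *: e i].

(* A relation rather than a function: an infinite-dimensional A satisfies
   has_dim A n for no n. In particular has_dim A n forces A to be a subspace. *)
Definition has_dim (K : fieldType) (W : lmodType K) (A : set W)
    (n : nat) : Prop :=
  exists e : 'I_n -> W, lin_indep e /\ A = lin_span e.

(* L(U,V), inside the K-module of all functions U -> V. *)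
Definition lin_op (K : fieldType) (U V : lmodType K) : set (U -> V) :=
  [set f | linear f].

Definition has_rank (K : fieldType) (U V : lmodType K) (f : U -> V)
    (r : nat) : Prop :=
  has_dim (range f) r.

Definition LLD (K : fieldType) (U V : lmodType K) (S : set (U -> V)) : Prop :=
  forall x : U, exists f : U -> V, [/\ S f, f <> 0 & f x = 0].

(* Main.v *)
Require Import Defs.
From HB Require Import structures.
From mathcomp Require Import all_boot all_order all_algebra perm.
From mathcomp Require Import boolp classical_sets functions cardinality.

Set Implicit Arguments.
Unset Strict Implicit.
Unset Printing Implicit Defensive.

Import GRing.Theory.
Local Open Scope ring_scope.

(* For x in U let x^ : S -> V be f |-> f x.  Choose x0 with x0^ of maximal rank
   r, so that r < n by local linear dependence.  A non-zero g in Ker x0^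
   satisfies Im g <= Im x0^ (otherwise s x0 + y would have larger rank for some
   s), hence rk g <= r <= n - 1.  If no non-zero element of S has rank less than
   n - 1, then r = n - 1 and Im g = Im x0^.  Given f in S, let t be an
   indeterminate, let f_t = g + t f, and let p be a projection of V onto Im g.
   As p g = p f_0 maps U onto Im g, x0 deforms to a vector x_t with
   p (f_t x_t) = 0; since p x_t^ still has rank n - 1, which is maximal, its
   kernel is that of x_t^, whence f_t x_t = 0.  The first step over K(t) then
   gives rk f_t <= n - 1, and the coefficients of highest degree of the n-minors
   of f_t show that rk f <= n - 1.  The passage to K(t) is where #K >= n enters:
   an n-minor of x^ is a polynomial of degree at most n - 1 in each coordinate
   of x, because its x_j^n coefficient is its value at the j-th basis vector, that is, 0. *)

(** * Top coefficients of polynomial determinants *)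

Lemma coefM_top (R : nzRingType) (p q : {poly R}) (a b : nat) :
  (size p <= a.+1)%N -> (size q <= b.+1)%N -> (p * q)`_(a + b) = p`_a * q`_b.
Proof.
move=> szp szq; have lt_a : (a < (a + b).+1)%N by rewrite ltnS leq_addr.
rewrite coefM (bigD1 (Ordinal lt_a)) //= addKn big1 ?addr0 // => i ne_ia.
have [lt_ia | lt_ai | eq_ia] := ltngtP i a.
- rewrite [q`__]nth_default ?mulr0 //; apply: leq_trans szq _.
  by rewrite ltn_subRL ltn_add2r.
- by rewrite nth_default ?mul0r // (leq_trans szp).
- by rewrite -val_eqE /= eq_ia eqxx in ne_ia.
Qed.

Lemma prod_coef_top (R : comNzRingType) (I : Type) (r : seq I)
    (p : I -> {poly R}) (k : I -> nat) :
    (forall i, (size (p i) <= (k i).+1)%N) ->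
  (size (\prod_(i <- r) p i)%R <= (\sum_(i <- r) k i).+1)%N /\
  (\prod_(i <- r) p i)`_(\sum_(i <- r) k i) = \prod_(i <- r) (p i)`_(k i).
Proof.
move=> szp; elim: r => [|i r [szr cr]]; first by rewrite !big_nil size_poly1 coef1.
rewrite !big_cons coefM_top // cr; split=> //.
apply: leq_trans (size_polyMleq _ _) _.
by rewrite -subn1 leq_subLR add1n -addnS -addSn leq_add.
Qed.

(** Each Leibniz term takes one entry from every row, so degree bounds [k i] on the rows add up, and
    the top coefficient can be read row by row. *)
Lemma det_coef_top (R : comNzRingType) (n : nat) (M : 'M[{poly R}]_n)
    (k : 'I_n -> nat) :
    (forall i j, (size (M i j) <= (k i).+1)%N) ->
  (size (\det M) <= (\sum_i k i).+1)%N /\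
  (\det M)`_(\sum_i k i) = \det (\matrix_(i, j) (M i j)`_(k i)).
Proof.
move=> szM; pose top (s : 'S_n) :=
  prod_coef_top (index_enum 'I_n) (fun i => szM i (s i)).
have topE (s : 'S_n) : (\prod_i M i (s i))`_(\sum_i k i) =
    \prod_i (\matrix_(i, j) (M i j)`_(k i)) i (s i).
  by rewrite (top s).2 /=; apply: eq_bigr => i _; rewrite mxE.
rewrite /determinant coef_sum; split.
  apply: leq_trans (size_sum _ _ _) _; apply/bigmax_leqP => s _.
  by rewrite mulr_sign; case: odd_perm; rewrite ?size_polyN; apply: (top s).1.
apply: eq_bigr => s _; rewrite !mulr_sign.
by case: odd_perm; rewrite ?coefN topE.
Qed.

Lemma det_pencil_lead (R : comNzRingType) (n : nat) (A B : 'M[R]_n) :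
    let q := \det ('X *: map_mx polyC A + map_mx polyC B) in
  (size q <= n.+1)%N /\ q`_n = \det A.
Proof.
move=> q; have /(_ (fun=> 1%N)) := @det_coef_top R n ('X *: map_mx polyC A + map_mx polyC B).
rewrite sum1_card card_ord; case=> [|szq cq].
  move=> i j; rewrite !mxE; apply: leq_trans (size_polyD _ _) _.
  rewrite geq_max (leq_trans (size_polyC_leq1 _)) // andbT mulrC mul_polyC.
  by apply: leq_trans (size_scale_leq _ _) _; rewrite size_polyX.
split=> //; rewrite {}/q cq; congr (\det _); apply/matrixP=> i j.
by rewrite !mxE coefD coefXM coefC /= coefC addr0.
Qed.

Lemma horner_pencil (R : comNzRingType) (m n : nat) (A B : 'M[R]_(m, n)) (z : R) :
  map_mx (horner_eval z) ('X *: map_mx polyC A + map_mx polyC B) = z *: A + B.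
Proof.
by apply/matrixP=> i j; rewrite !mxE horner_evalE !hornerE.
Qed.

(** * Vanishing of determinants tested at finitely many points *)

Lemma poly_eq0_roots (L : idomainType) (p : {poly L}) (zs : seq L) :
  uniq zs -> (size p <= size zs)%N -> {in zs, forall z, p.[z] = 0} -> p = 0.
Proof.
move=> uzs szp rp; apply/eqP; apply: contraLR szp => p0; rewrite -ltnNge.
by apply: max_poly_roots uzs => //; apply/allP=> z /rp pz; apply/rootP.
Qed.

(** The coordinates are freed from [Z] one at a time: after stage [k] those of index below [k] are
    arbitrary. In use, [Z] is the image of a subfield. *)
Lemma det_comb_eq0 (L : idomainType) (n m : nat) (A : 'I_m -> 'M[L]_n)
    (Z : L -> Prop) (zs : seq L) :
    Z 0 -> Z 1 -> uniq zs -> {in zs, forall z, Z z} -> (n <= size zs)%N ->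
    (forall x : 'I_m -> L, (forall j, Z (x j)) ->
       \det (\sum_j x j *: A j) = 0) ->
  forall x : 'I_m -> L, \det (\sum_j x j *: A j) = 0.
Proof.
move=> Z0 Z1 uzs Zzs szs detZ.
suff H k (x : 'I_m -> L) : (forall j : 'I_m, (k <= j)%N -> Z (x j)) ->
    \det (\sum_j x j *: A j) = 0.
  by move=> x; apply: (H m) => j; rewrite leqNgt ltn_ord.
elim: k x => [|k IHk] x Zx; first by apply: detZ => j; apply: Zx.
have [lt_km | le_mk] := ltnP k m; last first.
  by apply: IHk => j le_kj; have := ltn_ord j; rewrite ltnNge (leq_trans le_mk).
pose i := Ordinal lt_km.
pose B := \sum_(j | j != i) x j *: A j.
have [szq] := det_pencil_lead (A i) B; set q := \det _ in szq * => qn.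
have detAi : \det (A i) = 0.
  have := detZ (fun j => (j == i)%:R) _; rewrite (bigD1 i) //= eqxx scale1r.
  rewrite big1 ?addr0; first by apply=> j; case: eqP.
  by move=> j /negPf ->; rewrite scale0r.
have qz z : q.[z] = \det (z *: A i + B).
  by rewrite -horner_evalE -det_map_mx horner_pencil.
have q0 : q = 0.
  apply: (poly_eq0_roots uzs).
    (* The coefficient of degree [n] is [\det (A i) = 0], so [q] has degree below [n] and [n] roots
       suffice. *)
    apply: leq_trans szs; rewrite leq_eqVlt in szq; case/orP: szq => // /eqP szq.
    have : lead_coef q = 0 by rewrite lead_coefE szq qn.
    by move/eqP; rewrite lead_coef_eq0 -size_poly_eq0 szq.
  move=> z zs_z; rewrite qz.
  have := IHk (fun j => if j == i then z else x j); rewrite (bigD1 i) //= eqxx.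
  rewrite (eq_bigr (fun j => x j *: A j)); last by move=> j /negPf->.
  apply=> j le_kj; case: eqP => [_|/eqP ne_ji]; first exact: Zzs.
  by apply: Zx; rewrite ltn_neqAle le_kj andbT eq_sym.
by rewrite (bigD1 i) //= -qz q0 horner0.
Qed.

(** Otherwise [c *m B] would complete a basis of the row space of [A] to [r + 1] independent rows.
    The corresponding minor of [z *: A + B] would be a non-zero polynomial in [z] of degree at most
    [r], yet it vanishes at more than [r] points. *)
Lemma kermx_pencil_sub (F : fieldType) (n d : nat) (A B : 'M[F]_(n, d))
    (c : 'rV_n) (zs : seq F) :
    uniq zs -> (\rank A < size zs)%N ->
    (forall z, \rank (z *: A + B)%R <= \rank A)%N ->
  c *m A = 0 -> (c *m B <= A)%MS.
Proof.
move=> uzs szs rkz cA0; apply: contraT => nsub.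
set r := \rank A in szs rkz; pose W : 'M_(r, d) := row_base A; pose u := c *m B.
have /submxP[R defW] : (W <= A)%MS by rewrite eq_row_base.
have ltr : (r < \rank (col_mx W u))%N.
  rewrite -addsmxE.
  have rW : \rank W = r by rewrite eq_row_base.
  by rewrite -[X in (X < _)%N]rW; apply: rank_ltmx; rewrite ltmxE
    addsmxSl /= addsmx_sub submx_refl /= eq_row_base.
have /row_freeP[P WuP] : row_free (col_mx W u).
  by rewrite /row_free eqn_leq rank_leq_row (leq_trans _ ltr) ?addn1.
pose M : 'M[{poly F}]_(r + 1) := col_mx
  ('X *: map_mx polyC (W *m P) + map_mx polyC (R *m B *m P)) (map_mx polyC (u *m P)).
(* The last row of M is constant, so \det M has degree at most r, with leading
   coefficient \det 1. *)
pose k (i : 'I_(r + 1)) : nat := (i < r)%N.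
have kl i : k (lshift 1 i) = 1%N by rewrite /k /= ltn_ord.
have kr i : k (rshift r i) = 0%N by rewrite /k /= ltnNge leq_addr.
have sumk : (\sum_i k i = r)%N.
  rewrite big_split_ord /= (eq_bigr (fun=> 1%N)) => [|i _]; last exact: kl.
  by rewrite sum1_card card_ord big1 ?addn0.
have [|szM] := @det_coef_top F (r + 1) M k.
  move=> i j; rewrite /M -[i]fintype.splitK; case: (fintype.split i) => i' /=.
    rewrite kl col_mxEu !mxE; apply: leq_trans (size_polyD _ _) _.
    rewrite geq_max (leq_trans (size_polyC_leq1 _)) // andbT mulrC mul_polyC.
    by apply: leq_trans (size_scale_leq _ _) _; rewrite size_polyX.
  by rewrite kr col_mxEd mxE size_polyC_leq1.
rewrite sumk (_ : \matrix_(i, j) _ = 1%:M) ?det1.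
  suff -> : \det M = 0 by rewrite coef0 => /esym/eqP; rewrite oner_eq0.
  apply: (poly_eq0_roots uzs); first by rewrite (leq_trans szM) ?sumk.
  move=> z _; rewrite -horner_evalE -det_map_mx.
  (* As [c *m A = 0], the constant last row is also [c *m (z *: A + B) *m P]; hence the whole matrix
     factors through the pencil and has rank at most [r]. *)
  have -> : map_mx (horner_eval z) M = col_mx R c *m (z *: A + B) *m P.
    rewrite map_col_mx horner_pencil !mul_col_mx; congr col_mx.
      by rewrite mulmxDr mulmxDl -scalemxAr -defW scalemxAl.
    rewrite mulmxDr -scalemxAr cA0 scaler0 add0r.
    by apply/matrixP=> i j; rewrite !mxE horner_evalE hornerC.
  apply/eqP; rewrite -[_ == 0]negbK -unitfE -unitmxE -row_free_unit.
  rewrite /row_free neq_ltn; apply/orP; left; rewrite [X in (_ < X)%N]addn1 ltnS.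
  apply: leq_trans (rkz z); apply: leq_trans (mxrankM_maxl _ _) _.
  exact: mxrankM_maxr.
rewrite -WuP; apply/matrixP=> i j; rewrite [LHS]mxE.
rewrite /M mul_col_mx -[i]fintype.splitK; case: (fintype.split i) => i' /=.
  by rewrite kl !col_mxEu !mxE coefD coefXM !coefC /= addr0.
by rewrite kr !col_mxEd !mxE coefC.
Qed.

(** * Operator spaces in matrix form *)

(* The rows of the T i are the images of a basis of U: evalmx T x is the matrix of
   x^, and combmx T c that of the operator with coordinates c in S. *)
Definition evalmx (R : comNzRingType) n m d (T : 'I_n -> 'M[R]_(m, d)) (x : 'rV_m) :
  'M[R]_(n, d) := \matrix_i (x *m T i).

Definition combmx (R : comNzRingType) n m d (T : 'I_n -> 'M[R]_(m, d)) (c : 'rV_n) :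
  'M[R]_(m, d) := \sum_i c 0 i *: T i.

Lemma mul_evalmx (R : comNzRingType) n m d (T : 'I_n -> 'M[R]_(m, d)) c x :
  c *m evalmx T x = x *m combmx T c.
Proof.
rewrite mulmx_sum_row mulmx_sumr; apply: eq_bigr => i _.
by rewrite rowK scalemxAr.
Qed.

Lemma evalmxD (R : comNzRingType) n m d (T : 'I_n -> 'M[R]_(m, d)) a x y :
  evalmx T (a *: x + y) = a *: evalmx T x + evalmx T y.
Proof.
by apply/row_matrixP=> i; rewrite linearP /= !rowK mulmxDl scalemxAl.
Qed.

Lemma combmxD (R : comNzRingType) n m d (T : 'I_n -> 'M[R]_(m, d)) a b c :
  combmx T (a *: b + c) = a *: combmx T b + combmx T c.
Proof.
rewrite scaler_sumr -big_split; apply: eq_bigr => i _ /=.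
by rewrite !mxE scalerDl scalerA.
Qed.

Lemma evalmx_sum (R : comNzRingType) n m d (T : 'I_n -> 'M[R]_(m, d)) x :
  evalmx T x = \sum_j x 0 j *: evalmx T (delta_mx 0 j).
Proof.
apply/row_matrixP=> i; rewrite linear_sum rowK {1}[x]row_sum_delta mulmx_suml.
by apply: eq_bigr => j _; rewrite linearZ /= rowK scalemxAl.
Qed.

Lemma map_evalmx (R R' : comNzRingType) (f : {rmorphism R -> R'}) n m d
    (T : 'I_n -> 'M[R]_(m, d)) x :
  map_mx f (evalmx T x) = evalmx (fun i => map_mx f (T i)) (map_mx f x).
Proof. by apply/row_matrixP=> i; rewrite -map_row !rowK map_mxM. Qed.

Lemma map_combmx (R R' : comNzRingType) (f : {rmorphism R -> R'}) n m d
    (T : 'I_n -> 'M[R]_(m, d)) c :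
  map_mx f (combmx T c) = combmx (fun i => map_mx f (T i)) (map_mx f c).
Proof.
by rewrite map_mx_sum; apply: eq_bigr => i _; rewrite map_mxZ mxE.
Qed.

(** If some [y] over [L] gave rank [n], with right inverse [P], then [\det (evalmx TL x *m P)] would
    vanish at all points [x] coming from [K], hence identically, although it is 1 at [y]. *)
Lemma rank_evalmx_map (K L : fieldType) (f : {rmorphism K -> L}) n m d
    (T : 'I_n -> 'M[K]_(m, d)) (zs : seq K) :
    uniq zs -> (n <= size zs)%N ->
    (forall x, \rank (evalmx T x) < n)%N ->
  forall y, (\rank (evalmx (fun i => map_mx f (T i)) y) < n)%N.
Proof.
move=> uzs szs rkT y; rewrite ltnNge; apply/negP => le_n.
set TL := fun i => _ in le_n *.
have /row_freeP[P yP] : row_free (evalmx TL y) by rewrite /row_free eqn_leq rank_leq_row.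
pose A j := evalmx TL (delta_mx 0 j) *m P.
have sumA (x : 'rV_m) : \sum_j x 0 j *: A j = evalmx TL x *m P.
  rewrite [evalmx TL x]evalmx_sum mulmx_suml.
  by apply: eq_bigr => j _; rewrite scalemxAl.
suff /eqP : \det (\sum_j y 0 j *: A j) = 0 by rewrite sumA yP det1 oner_eq0.
apply: (@det_comb_eq0 L n m A (fun z => exists a, z = f a) (map f zs)).
- by exists 0; rewrite rmorph0.
- by exists 1; rewrite rmorph1.
- by rewrite map_inj_uniq //; apply: fmorph_inj.
- by move=> _ /mapP[a _ ->]; exists a.
- by rewrite size_map.
move=> x /fin_all_exists[a xa].
have -> : \sum_j x j *: A j = map_mx f (evalmx T (\row_j a j)) *m P.
  by rewrite map_evalmx -sumA; apply: eq_bigr => j _; rewrite !mxE xa.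
apply/eqP; rewrite -[_ == 0]negbK -unitfE -unitmxE -row_free_unit.
rewrite /row_free neq_ltn; apply/orP; left.
by apply: leq_ltn_trans (mxrankM_maxl _ _) _; rewrite mxrank_map.
Qed.

(** Row [j] of [combmx T c] is [c] times the evaluation matrix of the [j]-th basis vector, and
    evaluating at [z *: x + y] gives a pencil of rank at most that at [x]. *)
Lemma combmx_sub (F : fieldType) n m d (T : 'I_n -> 'M[F]_(m, d)) x c (zs : seq F) :
    uniq zs -> (\rank (evalmx T x) < size zs)%N ->
    (forall y, \rank (evalmx T y) <= \rank (evalmx T x))%N ->
  c *m evalmx T x = 0 -> (combmx T c <= evalmx T x)%MS.
Proof.
move=> uzs szs rkT cx0; apply/row_subP=> j.
rewrite rowE -mul_evalmx; apply: (kermx_pencil_sub uzs) => // z.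
by rewrite -evalmxD.
Qed.

(** * The rank bound through deformation over K(t) *)

(** A coordinate-free substitute for choosing an invertible minor of maximal size: [R] extracts a
    row basis and [P] is a right inverse of it. *)
Lemma row_basis_minor (F : fieldType) m d (A : 'M[F]_(m, d)) :
  exists (R : 'M_(\rank A, m)) (P : 'M_(d, \rank A)), R *m A *m P = 1%:M.
Proof.
have /submxP[R defR] : (row_base A <= A)%MS by rewrite eq_row_base.
have /row_freeP[P RP] := row_base_free A.
by exists R, P; rewrite -defR.
Qed.

Lemma mulmx_eq0_rank (F : fieldType) a n d e (c : 'M[F]_(a, n)) (X : 'M_(n, d))
    (Q : 'M_(d, e)) :
  (\rank X <= \rank (X *m Q))%N -> c *m X *m Q = 0 -> c *m X = 0.
Proof.
move=> rkX cXQ0; have eqrk : \rank (X *m Q) = \rank X.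
  by apply/eqP; rewrite eqn_leq rkX mxrankM_maxl.
have kerS : (kermx X <= kermx (X *m Q))%MS.
  by apply/sub_kermxP; rewrite mulmxA mulmx_ker mul0mx.
have kerE : (kermx (X *m Q) <= kermx X)%MS.
  by rewrite -(mxrank_leqif_sup kerS) !mxrank_ker eqrk.
by apply/sub_kermxP; apply: submx_trans kerE; apply/sub_kermxP; rewrite mulmxA.
Qed.

(* L stands for K(t); it is kept abstract because unification diverges on the
   concrete field of fractions. *)
Lemma rank_combmx_ltn_ext (K L : fieldType) (iota : {rmorphism {poly K} -> L})
    n m d (T : 'I_n -> 'M[K]_(m, d))
    (x0 : 'rV_m) (c0 c : 'rV_n) (zs : seq K) :
    injective iota -> uniq zs -> (n <= size zs)%N ->
    (forall x, \rank (evalmx T x) < n)%N ->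
    \rank (evalmx T x0) = n.-1 -> c0 *m evalmx T x0 = 0 ->
    (n.-1 <= \rank (combmx T c0))%N ->
  (\rank (combmx T c) < n)%N.
Proof.
move=> iotaI uzs szs rkT rk0 c0x0 rkc0.
have n_gt0 : (0 < n)%N by apply: leq_ltn_trans (rkT x0).
have rkTr x : (\rank (evalmx T x) <= n.-1)%N by rewrite -ltnS prednK.
have sub0 : (combmx T c0 <= evalmx T x0)%MS.
  apply: (combmx_sub uzs) => //; first exact: leq_trans (rkT _) szs.
  by move=> x; rewrite rk0.
have sup0 : (evalmx T x0 <= combmx T c0)%MS.
  by rewrite -(mxrank_leqif_sup sub0) eqn_leq mxrankS // rk0.
have [H [Q HQ1]] := row_basis_minor (evalmx T x0).
move: HQ1; move: H Q; rewrite rk0 => H Q HQ1.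
(* [Q] plays the role of the projection onto Im g, identified with the space of rows of length n -
   1; the rows of [G] are preimages under g of the basis of Im g dual to [Q]. *)
have /submxP[G defG] : (H *m evalmx T x0 <= combmx T c0)%MS.
  by apply: submx_trans sup0; apply: submxMl.
have GQ1 : G *m combmx T c0 *m Q = 1%:M by rewrite -defG.
pose D := {poly K}; pose p a b (A : 'M[K]_(a, b)) : 'M[D]_(a, b) := map_mx polyC A.
pose ev a b (A : 'M[D]_(a, b)) : 'M[K]_(a, b) := map_mx (horner_eval 0) A.
have evp a b (A : 'M_(a, b)) : ev _ _ (p _ _ A) = A.
  by apply/matrixP=> i j; rewrite !mxE horner_evalE hornerC.
pose Tp i := p _ _ (T i); pose ct := p _ _ c0 + 'X *: p _ _ c.
have evX y : ev _ _ (evalmx Tp y) = evalmx T (ev _ _ y).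
  by apply/row_matrixP=> i; rewrite -map_row !rowK /ev map_mxM [map_mx _ (Tp i)]evp.
pose Tt := combmx Tp ct.
have TtE : Tt = 'X *: p _ _ (combmx T c) + p _ _ (combmx T c0).
  by rewrite /p !map_combmx -combmxD addrC.
have evTt : ev _ _ Tt = combmx T c0 by rewrite TtE /ev horner_pencil scale0r add0r.
(* The matrix of p f_t on the preimages [G]; it is the identity at t = 0. *)
pose E := p _ _ G *m Tt *m p _ _ Q.
have evE : ev _ _ E = 1%:M by rewrite /ev !map_mxM -!/(ev _ _ _) evTt !evp.
(* x_t, multiplied by \det E to make it polynomial in t *)
pose y := \det E *: p _ _ x0 - p _ _ x0 *m Tt *m p _ _ Q *m \adj E *m p _ _ G.
have yTQ : y *m Tt *m p _ _ Q = 0.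
  rewrite !mulmxBl -!scalemxAl -!mulmxA [p _ _ G *m _]mulmxA -/E mul_adj_mx.
  by rewrite !mulmxA mul_mx_scalar subrr.
have evy : ev _ _ y = x0.
  rewrite /ev map_mxB map_mxZ !map_mxM -!/(ev _ _ _) evTt !evp -det_map_mx -/(ev _ _ E).
  by rewrite evE det1 scale1r -mul_evalmx c0x0 !mul0mx subr0.
(* At t = 0 this minor is [H *m evalmx T x0 *m Q = 1%:M], so it is a non-zero polynomial; hence p
   x_t^ has rank n - 1 over [L]. *)
have detX : \det (p _ _ H *m evalmx Tp y *m p _ _ Q) != 0.
  apply/eqP => /(congr1 (horner_eval 0)); rewrite -det_map_mx !map_mxM -!/(ev _ _ _).
  by rewrite evX evy !evp HQ1 det1 horner_evalE horner0 => /eqP; rewrite oner_eq0.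
have iota_eq0 z : (iota z == 0) = (z == 0) by rewrite -(inj_eq iotaI) rmorph0.
pose f : {rmorphism K -> L} := iota \o polyC.
pose j a b (A : 'M[D]_(a, b)) : 'M[L]_(a, b) := map_mx iota A.
have rkTL z : (\rank (evalmx (fun i => j _ _ (Tp i)) z) < n)%N.
  have -> : evalmx (fun i => j _ _ (Tp i)) z = evalmx (fun i => map_mx f (T i)) z.
    by apply/row_matrixP=> i; rewrite !rowK /j /Tp /p -map_mx_comp.
  exact: rank_evalmx_map uzs szs rkT z.
pose TL i := j _ _ (Tp i); pose X := evalmx TL (j _ _ y).
have jX : j _ _ (evalmx Tp y) = X by apply: map_evalmx.
have jTt : j _ _ Tt = combmx TL (j _ _ ct) by apply: map_combmx.
have rkXQ : (n.-1 <= \rank (X *m j _ _ (p _ _ Q)))%N.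
  have : j _ _ (p _ _ H *m evalmx Tp y *m p _ _ Q) \in unitmx.
    by rewrite unitmxE det_map_mx unitfE iota_eq0.
  rewrite -row_free_unit /row_free /j !map_mxM -!/(j _ _ _) jX -mulmxA => /eqP rk1.
  rewrite -[X in (X <= _)%N]rk1; exact: mxrankM_maxr.
have rkX : \rank X = n.-1.
  apply/eqP; rewrite eqn_leq (leq_trans rkXQ) ?mxrankM_maxl // andbT.
  by rewrite -ltnS prednK ?rkTL.
(* Composing with [Q] loses no rank, so p (f_t x_t) = 0 lifts to f_t x_t = 0. *)
have ctX : j _ _ ct *m X = 0.
  apply: (@mulmx_eq0_rank _ _ _ _ _ _ _ (j _ _ (p _ _ Q))); first by rewrite rkX.
  by rewrite mul_evalmx -jTt -!map_mxM yTQ; apply: map_mx0.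
have subX : (j _ _ Tt <= X)%MS.
  rewrite jTt; apply: (@combmx_sub _ _ _ _ _ _ _ (map f zs)) => //.
  - by rewrite map_inj_uniq //; apply: fmorph_inj.
  - by rewrite rkX size_map (leq_trans _ szs) ?prednK.
  by move=> z; rewrite [X in (_ <= X)%N]rkX -ltnS prednK ?rkTL.
rewrite ltnNge; apply/negP => le_n.
(* If f had rank [r >= n], a minor of f_t of size [r] would vanish, as f_t has rank below [n],
   whereas its coefficient of degree [r] in t is the same minor of f, namely 1. *)
have [R [P RP1]] := row_basis_minor (combmx T c); set r := \rank _ in le_n R P RP1.
have det0 : \det (p _ _ R *m Tt *m p _ _ P) = 0.
  apply/eqP; rewrite -iota_eq0 -det_map_mx -[_ == 0]negbK -unitfE -unitmxE.
  rewrite -row_free_unit /row_free neq_ltn; apply/orP; left; apply: leq_trans le_n.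
  rewrite !map_mxM; apply: leq_ltn_trans (mxrankM_maxl _ _) _.
  apply: leq_ltn_trans (mxrankM_maxr _ _) _; apply: leq_ltn_trans (mxrankS subX) _.
  by rewrite rkX ltn_predL.
have [_] := det_pencil_lead (R *m combmx T c *m P) (R *m combmx T c0 *m P).
rewrite RP1 det1 (_ : _ + _ = p _ _ R *m Tt *m p _ _ P).
  by rewrite det0 coef0 => /esym/eqP; rewrite oner_eq0.
by rewrite TtE mulmxDr mulmxDl /p !map_mxM -scalemxAr -scalemxAl -RP1 !map_mxM.
Qed.

Lemma rank_combmx_ltn (K : fieldType) n m d (T : 'I_n -> 'M[K]_(m, d))
    (x0 : 'rV_m) (c0 c : 'rV_n) (zs : seq K) :
    uniq zs -> (n <= size zs)%N ->
    (forall x, \rank (evalmx T x) < n)%N ->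
    \rank (evalmx T x0) = n.-1 -> c0 *m evalmx T x0 = 0 ->
    (n.-1 <= \rank (combmx T c0))%N ->
  (\rank (combmx T c) < n)%N.
Proof.
apply: (@rank_combmx_ltn_ext _ {fraction {poly K}} (@tofrac {poly K})).
by move=> p q /eqP; rewrite tofrac_eq => /eqP.
Qed.

(** * Finite families in arbitrary vector spaces *)

Local Open Scope classical_set_scope.
Local Open Scope card_scope.
Local Open Scope ring_scope.

Definition lincomb (K : fieldType) (W : lmodType K) (d : nat) (b : 'I_d -> W)
  (a : 'rV[K]_d) : W := \sum_i a 0 i *: b i.

Lemma lincombP (K : fieldType) (W : lmodType K) (d : nat) (b : 'I_d -> W) t a a' :
  lincomb b (t *: a + a') = t *: lincomb b a + lincomb b a'.
Proof.
rewrite scaler_sumr -big_split; apply: eq_bigr => i _ /=.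
by rewrite !mxE scalerDl scalerA.
Qed.

Lemma lincomb0 (K : fieldType) (W : lmodType K) (d : nat) (b : 'I_d -> W) :
  lincomb b 0 = 0.
Proof. by rewrite /lincomb big1 // => i _; rewrite mxE scale0r. Qed.

Lemma lincomb_delta (K : fieldType) (W : lmodType K) (d : nat) (b : 'I_d -> W) j :
  lincomb b (delta_mx 0 j) = b j.
Proof.
rewrite /lincomb (bigD1 j) //= mxE !eqxx scale1r big1 ?addr0 // => i /negPf ne_ij.
by rewrite mxE ne_ij andbF scale0r.
Qed.

Lemma lincomb_mulmx (K : fieldType) (W : lmodType K) (d k : nat) (b : 'I_d -> W)
    (A : 'M_(k, d)) a :
  lincomb b (a *m A) = lincomb (fun i => lincomb b (row i A)) a.
Proof.
rewrite mulmx_sum_row {2}/lincomb; elim/big_rec2: _ => [|i x y _ <-].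
  exact: lincomb0.
by rewrite lincombP.
Qed.

Lemma lin_indepP (K : fieldType) (W : lmodType K) (d : nat) (b : 'I_d -> W) :
  lin_indep b <-> (forall a, lincomb b a = 0 -> a = 0).
Proof.
split=> [ib a /ib a0 | ib c c0 i].
  by apply/rowP=> i; rewrite a0 mxE.
have /ib/rowP/(_ i) : lincomb b (\row_i c i) = 0; last by rewrite !mxE.
by rewrite -[RHS]c0; apply: eq_bigr => j _; rewrite mxE.
Qed.

Lemma lin_spanP (K : fieldType) (W : lmodType K) (d : nat) (b : 'I_d -> W) w :
  lin_span b w <-> (exists a, w = lincomb b a).
Proof.
split=> [[c ->] | [a ->]]; last by exists (a 0).
by exists (\row_i c i); apply: eq_bigr => j _; rewrite mxE.
Qed.

Lemma lin_indep_lincomb (K : fieldType) (W : lmodType K) (d k : nat) (b : 'I_d -> W)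
    (A : 'M_(k, d)) :
  lin_indep b -> lin_indep (fun i => lincomb b (row i A)) <-> row_free A.
Proof.
move=> /lin_indepP ib; split=> [/lin_indepP iA | fA].
  rewrite -kermx_eq0; apply/rowV0P => v /sub_kermxP vA0.
  by apply: iA; rewrite -lincomb_mulmx vA0 lincomb0.
apply/lin_indepP => a; rewrite -lincomb_mulmx => /ib.
by move/(congr1 (mulmx^~ (pinvmx A))); rewrite -mulmxA mulmxVp // mulmx1 mul0mx.
Qed.

Lemma linear_lincomb (K : fieldType) (U V : lmodType K) (f : U -> V) (d : nat)
    (u : 'I_d -> U) a :
  linear f -> f (lincomb u a) = lincomb (f \o u) a.
Proof.
move=> lf; pose F : {linear U -> V} := HB.pack f (GRing.isLinear.Build K U V _ f lf).
rewrite -[f]/(F : U -> V) linear_sum; apply: eq_bigr => i _.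
by rewrite linearZ.
Qed.

Definition extend_family (W : Type) (d : nat) (w : W) (b : 'I_d -> W) (i : 'I_d.+1) :=
  oapp b w (unlift ord0 i).

Lemma lin_indep_extend (K : fieldType) (W : lmodType K) (d : nat) (b : 'I_d -> W) w :
  lin_indep b -> ~ lin_span b w -> lin_indep (extend_family w b).
Proof.
move=> ib nw c; rewrite big_ord_recl {1}/extend_family unlift_none /=.
under eq_bigr do rewrite /extend_family liftK /=.
move=> c0; have c00 : c ord0 = 0.
  apply: contra_notP nw => /eqP nz; exists (fun i => - ((c ord0)^-1 * c (lift ord0 i))).
  under eq_bigr do rewrite scaleNr -scalerA.
  rewrite sumrN -scaler_sumr; apply: (scalerI nz).
  by rewrite scalerN scalerA divff // scale1r; apply/eqP; rewrite -addr_eq0 c0.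
rewrite c00 scale0r add0r in c0.
by move=> i; case: (unliftP ord0 i) => [j|] ->; rewrite ?c00 //; apply: (ib (c \o lift ord0)).
Qed.

Lemma span_extend (K : fieldType) (W : lmodType K) (d : nat) (b : 'I_d -> W) w v :
  w = v \/ lin_span b v -> lin_span (extend_family w b) v.
Proof.
move=> [<- | [c ->]].
  apply/lin_spanP; exists (delta_mx 0 ord0).
  by rewrite lincomb_delta /extend_family unlift_none.
exists (fun i => oapp c 0 (unlift ord0 i)).
rewrite big_ord_recl unlift_none scale0r add0r.
by apply: eq_bigr => i _; rewrite /extend_family liftK.
Qed.

Lemma span_basis (K : fieldType) (W : lmodType K) (s : seq W) :
  exists d (b : 'I_d -> W), lin_indep b /\ {in s, forall w, lin_span b w}.
Proof.
elim: s => [|w s [d [b [ib bs]]]].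
  by exists 0, (fun=> 0); split=> // c _ [].
have [bw | nbw] := pselect (lin_span b w).
  by exists d, b; split=> // v /predU1P[-> // | /bs].
exists d.+1, (extend_family w b); split; first exact: lin_indep_extend.
by move=> v /predU1P[-> | /bs bv]; apply: span_extend; [left | right].
Qed.

(** Let [r.+1] be the least size for which no family has independent images. Some [r] vectors have
    independent images, and these span the range, since otherwise the family could be extended. *)
Lemma has_rank_lt (K : fieldType) (U V : lmodType K) (f : U -> V) (k : nat) :
    linear f -> (forall u : 'I_k -> U, ~ lin_indep (f \o u)) ->
  exists2 r, (r < k)%N & has_rank f r.
Proof.
move=> lf nk; pose P k := `[< forall u : 'I_k -> U, ~ lin_indep (f \o u) >].
have [|k0 /asboolP nk0 k0_min] := @ex_minnP P; first by exists k; apply/asboolP.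
have le_k0 : (k0 <= k)%N by apply: k0_min; apply/asboolP.
case: k0 => [|r] in nk0 k0_min le_k0 *.
  by case: (nk0 (fun=> 0)) => c _ [].
have [u iu] : exists u : 'I_r -> U, lin_indep (f \o u).
  apply: contrapT => nu; suff /k0_min : P r by rewrite ltnn.
  by apply/asboolP => u iu; apply: nu; exists u.
exists r => //; exists (f \o u); split=> //; apply/seteqP; split=> v /=.
  case=> x _ <-; apply: contrapT => nx; apply: (nk0 (extend_family x u)).
  suff -> : f \o extend_family x u = extend_family (f x) (f \o u).
    exact: lin_indep_extend.
  by apply/funext => i; rewrite /extend_family /=; case: (unlift _ _).
by move=> /lin_spanP[a ->]; exists (lincomb u a); rewrite ?linear_lincomb.
Qed.

(** * Reduction to matrices on finite sets of vectors *)

(** Only finitely many vectors matter at a time, so infinite dimension is harmless: [u] lists [s],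
    possibly with dependencies, and [b] is a basis of a space containing all the [e i x]. *)
Lemma coordinates (K : fieldType) (U V : lmodType K) (n : nat) (e : 'I_n -> U -> V)
    (s : seq U) :
    (forall i, linear (e i)) ->
  exists m d (u : 'I_m -> U) (b : 'I_d -> V) (T : 'I_n -> 'M[K]_(m, d)),
  [/\ lin_indep b, {in s, forall x, exists a, x = lincomb u a} &
   forall c a, lincomb e c (lincomb u a) = lincomb b (c *m evalmx T a)].
Proof.
move=> le; have [d [b [ib bs]]] := span_basis [seq e i x | i <- enum 'I_n, x <- s].
pose u (j : 'I_(size s)) := s`_j.
have /fin_all_exists[t tP] i : exists t : 'I_(size s) -> 'rV_d,
    forall j, e i (u j) = lincomb b (t j).
  apply: (@fin_all_exists _ (fun=> 'rV_d) (fun j r => e i (u j) = lincomb b r)) => j.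
  by apply/lin_spanP/bs/allpairsP; exists (i, u j); rewrite mem_enum mem_nth.
exists (size s), d, u, b, (fun i => \matrix_j t i j); split=> //.
  move=> x /[dup] s_x /(nthP 0)[j lt_j <-].
  by exists (delta_mx 0 (Ordinal lt_j)); rewrite lincomb_delta.
move=> c a; rewrite {1}/lincomb fct_sumE lincomb_mulmx; apply: eq_bigr => i _.
rewrite rowK lincomb_mulmx /GRing.scale /= linear_lincomb //; congr (_ *: _).
by apply: eq_bigr => j _; rewrite rowK /= tP.
Qed.

(** States that x^ has rank at least [k] without coordinates, so that ranks computed in different
    matrix models can be compared. *)
Definition rank_at_ge (K : fieldType) (U V : lmodType K) (n : nat)
    (e : 'I_n -> U -> V) (x : U) (k : nat) : Prop :=
  exists C : 'M[K]_(k, n), lin_indep (fun i => lincomb e (row i C) x).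

Lemma rank_at_geP (K : fieldType) (U V : lmodType K) (n m d : nat)
    (e : 'I_n -> U -> V) (u : 'I_m -> U) (b : 'I_d -> V) (T : 'I_n -> 'M[K]_(m, d))
    (a : 'rV_m) (k : nat) :
    lin_indep b ->
    (forall c, lincomb e c (lincomb u a) = lincomb b (c *m evalmx T a)) ->
  rank_at_ge e (lincomb u a) k <-> (k <= \rank (evalmx T a))%N.
Proof.
move=> ib eT; have indC (C : 'M_(k, n)) :
    lin_indep (fun i => lincomb e (row i C) (lincomb u a)) <-> row_free (C *m evalmx T a).
  rewrite -(lin_indep_lincomb _ ib).
  suff -> : (fun i => lincomb e (row i C) (lincomb u a)) =
            (fun i => lincomb b (row i (C *m evalmx T a))) by [].
  by apply/funext => i; rewrite eT row_mul.
split=> [[C /indC/eqP <-] | le_k]; first exact: mxrankM_maxr.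
have /submxP[D defD] : (row_base (evalmx T a) <= evalmx T a)%MS by rewrite eq_row_base.
exists (pid_mx k *m D); apply/indC.
rewrite -mulmxA -defD /row_free mxrankMfree ?row_base_free //.
by rewrite rank_pid_mx.
Qed.

Lemma lin_indep_image (K : fieldType) (U V : lmodType K) (n m d q : nat)
    (e : 'I_n -> U -> V) (u : 'I_m -> U) (b : 'I_d -> V) (T : 'I_n -> 'M[K]_(m, d))
    (c : 'rV_n) (x : 'I_q -> U) :
    lin_indep b ->
    (forall c a, lincomb e c (lincomb u a) = lincomb b (c *m evalmx T a)) ->
    (forall i, exists a, x i = lincomb u a) ->
  lin_indep (lincomb e c \o x) -> (q <= \rank (combmx T c))%N.
Proof.
move=> ib eT /fin_all_exists[a xa].
suff -> : lincomb e c \o x =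
    (fun i => lincomb b (row i (\matrix_i (a i) *m combmx T c))).
  by move=> /(lin_indep_lincomb _ ib)/eqP <-; apply: mxrankM_maxr.
by apply/funext => i; rewrite /= xa eT mul_evalmx row_mul rowK.
Qed.

Lemma card_ge_uniq (T : eqType) (n : nat) :
  `I_n #<= [set: T] -> exists2 zs : seq T, uniq zs & size zs = n.
Proof.
move=> /card_leP[f]; pose h (k : 'I_n) : `I_n := SigSub (mem_set (ltn_ord k : `I_n k)).
exists [seq val (f (h k)) | k <- enum 'I_n]; last by rewrite size_map size_enum_ord.
rewrite map_inj_uniq ?enum_uniq // => i j /val_inj /(@inj _ _ _ f) hij.
apply: val_inj; have /(congr1 val) := hij (mem_set I) (mem_set I); exact.
Qed.

(** * The dichotomy for ranks in an LLD space *)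

Theorem theorem3p14 (K : fieldType) (U V : lmodType K) (n : nat)
    (S : set (U -> V))
    (S_lin : S `<=` @lin_op K U V)
    (S_sub : submod_closed [in S])
    (S_dim : has_dim S n)
    (S_LLD : LLD S)
    (K_card : `I_n #<= [set: K]) :
  (exists f : U -> V, [/\ S f, f <> 0 &
     exists r : nat, (r < n.-1)%N /\ has_rank f r])
  \/ (forall f : U -> V, S f -> f <> 0 -> has_rank f n.-1).
Proof.
have [zs uzs szs] := card_ge_uniq K_card.
have [e [ie SE]] := S_dim.
have Scomb f : S f <-> exists c, f = lincomb e c by rewrite SE; apply: lin_spanP.
have le i : linear (e i).
  by apply/S_lin/Scomb; exists (delta_mx 0 i); rewrite lincomb_delta.
have LLDc x : exists c, [/\ c != 0, lincomb e c <> 0 & lincomb e c x = 0].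
  have [f [/Scomb[c ->] f0 fx0]] := S_LLD x; exists c; split=> //.
  by apply: contra_notN f0 => /eqP ->; rewrite lincomb0.
have rk_lt x k : rank_at_ge e x k -> (k < n)%N.
  have [m [d [u [b [T [ib us eT]]]]]] := coordinates [:: x] le.
  have [a ->] := us x (mem_head _ _).
  move=> /(rank_at_geP _ ib (fun c => eT c a)) le_k; apply: leq_ltn_trans le_k _.
  have [c [nz_c _ cx0]] := LLDc (lincomb u a); rewrite ltnNge; apply/negP => le_n.
  have fX : row_free (evalmx T a) by rewrite /row_free eqn_leq rank_leq_row.
  rewrite eT in cx0; move/lin_indepP/(_ _ cx0): ib => cX0.
  case/negP: nz_c; apply/eqP.
  by move/(congr1 (mulmx^~ (pinvmx (evalmx T a)))): cX0; rewrite -mulmxA mulmxVp // mulmx1 mul0mx.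
pose P k := `[< exists x, rank_at_ge e x k >].
(* [r] is the maximal rank of x^; the empty family shows that 0 is attained, and [n] is an upper
   bound. *)
have [||r /asboolP[x0 rk_x0] r_max] := @ex_maxnP P n.
- by exists 0; apply/asboolP; exists 0, 0 => c _ [].
- by move=> k /asboolP[x /rk_lt/ltnW].
have rk_le x k : rank_at_ge e x k -> (k <= r)%N.
  by move=> rk; apply: r_max; apply/asboolP; exists x.
have r_lt : (r < n)%N := rk_lt _ _ rk_x0.
have coords (s : seq U) : x0 \in s -> 
    exists m d (u : 'I_m -> U) (b : 'I_d -> V) (T : 'I_n -> 'M[K]_(m, d)) a0,
  [/\ lin_indep b, {in s, forall x, exists a, x = lincomb u a},
   forall c a, lincomb e c (lincomb u a) = lincomb b (c *m evalmx T a),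
   x0 = lincomb u a0 & \rank (evalmx T a0) = r /\ 
   forall a, (\rank (evalmx T a) <= r)%N].
  move=> s_x0; have [m [d [u [b [T [ib us eT]]]]]] := coordinates s le.
  have [a0 x0E] := us x0 s_x0; exists m, d, u, b, T, a0; split=> //.
  have rkX a : (\rank (evalmx T a) <= r)%N.
    by apply: (rk_le (lincomb u a)); apply/(rank_at_geP _ ib (fun c => eT c a)).
  split=> //; apply/eqP; rewrite eqn_leq rkX /=.
  by apply/(rank_at_geP _ ib (fun c => eT c a0)); rewrite -x0E.
have [g [nz_g g_neq0 gx0]] := LLDc x0.
(* Im g lies in Im x0^: this is checked in a matrix model containing [x0] and the given [x i]. *)
have g_indep q (x : 'I_q -> U) : lin_indep (lincomb e g \o x) -> (q <= r)%N.
  have [|m [d [u [b [T [a0 [ib us eT x0E [rk0 rkX]]]]]]]] := coords (x0 :: codom x).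
    exact: mem_head.
  have xu i : exists a, x i = lincomb u a.
    by apply: us; rewrite inE codom_f orbT.
  move=> /(lin_indep_image ib eT xu) le_q; apply: leq_trans le_q _.
  rewrite -rk0; apply: mxrankS; apply: (combmx_sub uzs); rewrite ?rk0 ?szs //.
  by move/lin_indepP: ib; apply; rewrite -eT -x0E.
have lin_comb c : linear (lincomb e c) by apply/S_lin/Scomb; exists c.
have [small | nsmall] := pselect (exists f : U -> V, [/\ S f, f <> 0 &
     exists r : nat, (r < n.-1)%N /\ has_rank f r]); [by left | right].
have rk_min f k : S f -> f <> 0 -> has_rank f k -> (n.-1 <= k)%N.
  move=> Sf f0 rkf; rewrite leqNgt; apply/negP => lt_k.
  by apply: nsmall; exists f; split=> //; exists k.
have [||r' lt_r' rk_g] := @has_rank_lt _ _ _ (lincomb e g) r.+1.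
- exact: lin_comb.
- by move=> x /g_indep; rewrite ltnn.
have le_r' : (n.-1 <= r')%N by apply: rk_min rk_g => //; apply/Scomb; exists g.
have n_gt0 : (0 < n)%N by apply: leq_ltn_trans r_lt.
have rE : r = n.-1.
  by apply/eqP; rewrite eqn_leq -ltnS prednK // r_lt (leq_trans le_r').
have {le_r' lt_r'} r'E : r' = n.-1.
  by apply/eqP; rewrite eqn_leq le_r' -rE -ltnS lt_r'.
move: rk_g; rewrite r'E => -[w [iw wE]].
(* The [v i] witness that g has rank at least n - 1 in any matrix model containing them. *)
have /fin_all_exists[v vE] i : exists y, lincomb e g y = w i.
  have : lin_span w (w i) by apply/lin_spanP; exists (delta_mx 0 i); rewrite lincomb_delta.
  by rewrite -wE => -[y _ <-]; exists y.
have iv : lin_indep (lincomb e g \o v).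
  by suff -> : lincomb e g \o v = w by []; apply/funext => i; apply: vE.
move=> f Sf f0; have [c fE] := (Scomb f).1 Sf.
(* Since f has rank at least n - 1, it remains to exclude [n] vectors [y i] with independent images;
   a matrix model containing [x0], [v] and [y] reduces this to [rank_combmx_ltn]. *)
have [||k lt_k rk_f] := @has_rank_lt _ _ _ f n; first 2 last.
- suff <- : k = n.-1 by [].
  by apply/eqP; rewrite eqn_leq -ltnS prednK // lt_k (rk_min f).
- by rewrite fE; apply: lin_comb.
move=> y; rewrite fE => iy.
have [|m [d [u [b [T [a0 [ib us eT x0E [rk0 rkX]]]]]]]] :=
    coords (x0 :: codom v ++ codom y); first exact: mem_head.
have vu i : exists a, v i = lincomb u a.
  by apply: us; rewrite inE mem_cat codom_f orbT.
have yu i : exists a, y i = lincomb u a.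
  by apply: us; rewrite inE mem_cat codom_f !orbT.
have le_n := lin_indep_image ib eT yu iy.
have := @rank_combmx_ltn _ _ _ _ T a0 g c zs uzs; rewrite szs ltnNge le_n => H.
suff : false by []; apply: H => //.
- by move=> a; apply: leq_ltn_trans (rkX a) r_lt.
- by rewrite rk0 rE.
- by move/lin_indepP: ib; apply; rewrite -eT -x0E.
- exact: (lin_indep_image ib eT vu iv).
Qed.
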